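(* Let $G=(N,\mathcal N,\Sigma,S,R)$ be an MCFTG. Then $L(G,A)=\mathrm{val}(L(G_{\mathrm{der}},A))$ for every $A\in\mathcal N$. In particular, $L(G)=\mathrm{val}(L(G_{\mathrm{der}}))$.
   Context: **Sequences and trees.** $\mathbb N_0$ is the set of nonnegative integers. $A^*$ (resp. $A^+$) is the set of finite (resp. nonempty finite) sequences over $A$; a sequence of length 1 is identified with its element; juxtaposition is concatenation; $\mathrm{occ}(w)$ is the set of elements occurring in the sequence $w$; $w$ is repetition-free if no element occurs twice in it. A ranked alphabet is a set $\Sigma$ with a rank map $\mathrm{rk}\colon\Sigma\to\mathbb N_0$ (applied elementwise to sequences); $\Sigma^{(k)}$ is the set of symbols of rank $k$. $T_\Sigma$ is the set of trees over $\Sigma$: the smallest set of strings over $\Sigma$ containing $\sigma t_1\cdots t_k$ (also written $\sigma(t_1,\dots,t_k)$) for all $\sigma\in\Sigma^{(k)}$ and $t_i\in T_\Sigma$. A forest is a finite sequence of trees. $X=\{x_1,x_2,\dots\}$ is a set of variables (of rank 0, disjoint from other alphabets), $X_k=\{x_1,\dots,x_k\}$. A pattern of rank $k$ over $\Sigma$ is a tree over $\Sigma\cup X_k$ in which each of $x_1,\dots,x_k$ occurs exactly once; $P_\Sigma(X_k)$ is the set of these and $P_\Sigma(X)=\bigcup_k P_\Sigma(X_k)$. For a forest $t$, $\mathrm{occ}_\Omega(t)$ is the set of symbols of $\Omega$ occurring in $t$; $t$ is uniquely $\Omega$-labeled if each symbol of $\Omega$ occurs at most once in $t$. **Substitution.**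 For a repetition-free sequence of symbols $\sigma=(\sigma_1,\dots,\sigma_n)$ and patterns $u=(u_1,\dots,u_n)$ with $\mathrm{rk}(u)=\mathrm{rk}(\sigma)$, $t[\sigma\gets u]$ is obtained from $t$ by replacing, recursively, each subtree $\sigma_i(s_1,\dots,s_k)$ by $u_i$ in which $x_j$ is replaced by the transformed $s_j$ (componentwise on forests). For $\mathcal L=\{B_1,\dots,B_k\}$ with $B_1\cdots B_k$ repetition-free and forests $f(B_i)$ with $\mathrm{rk}(f(B_i))=\mathrm{rk}(B_i)$, $t[B\gets f(B)\mid B\in\mathcal L]$ means $t[B_1\cdots B_k\gets f(B_1)\cdots f(B_k)]$. **MCFTG.** A multiple context-free tree grammar (MCFTG) is $G=(N,\mathcal N,\Sigma,S,R)$ where $N$ is a finite ranked alphabet of nonterminals; $\mathcal N\subseteq N^+$ is a finite set of repetition-free sequences (big nonterminals) with $\mathrm{occ}(A)\ne\mathrm{occ}(A')$ for distinct $A,A'\in\mathcal N$; $\Sigma$ is a finite ranked alphabet of terminals, disjoint from $N$, containing a symbol of rank at least 1; $S\in\mathcal N\cap N^{(0)}$ is the initial nonterminal; $R$ is a finite set of rules $A\to(u,\mathcal L)$ with $A\in\mathcal N$, $u\in P_{N\cup\Sigma}(X)^+$ a uniquely $N$-labeled forest with $\mathrm{rk}(u)=\mathrm{rk}(A)$, and $\mathcal L\subseteq\mathcal N$ (the links) such that the sets $\mathrm{occ}(B)$, $B\in\mathcal L$, are pairwise disjoint with union $\mathrm{occ}_N(u)$. **Least fixed point semantics.** The sets $L(G,A)\subseteq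 P_\Sigma(X)^*$, $A\in\mathcal N$, are simultaneously the smallest sets of forests such that for every rule $A\to(u,\mathcal L)\in R$ and every $f\colon\mathcal L\to P_\Sigma(X)^*$ with $\mathrm{rk}(f(B))=\mathrm{rk}(B)$ and $f(B)\in L(G,B)$ for all $B\in\mathcal L$, we have $u[B\gets f(B)\mid B\in\mathcal L]\in L(G,A)$. $L(G)=L(G,S)\subseteq T_\Sigma$. **Derivation trees.** For every rule fix a linear order on its links; a rule with $k$ links has rank $k$, so $R$ is a ranked alphabet. $G_{\mathrm{der}}$ is the regular tree grammar with nonterminals $\mathcal N$ (of rank 0), terminal ranked alphabet $R$, initial nonterminal $S$, and rules $A\to\rho(B_1,\dots,B_k)$ for every $\rho\in R$ with left-hand side $A$ and links $\{B_1,\dots,B_k\}$ (in that order). $L(G_{\mathrm{der}},A)\subseteq T_R$ is the set of trees over $R$ generated by $A$, and $L(G_{\mathrm{der}})=L(G_{\mathrm{der}},S)$. For $d=\rho(d_1,\dots,d_k)\in L(G_{\mathrm{der}},A)$ with $\rho=A\to(u,\{B_1,\dots,B_k\})$, the value is defined inductively by $\mathrm{val}(d)=u[B_i\gets\mathrm{val}(d_i)\mid1\le i\le k]$. *)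

(* Defs.v *)
From HB Require Import structures.
From mathcomp Require Import all_boot.
From mathcomp Require Import finmap classical_sets.
From Stdlib Require Import Relation_Operators.

Set Implicit Arguments.
Unset Strict Implicit.
Unset Printing Implicit Defensive.

Section Trees.
Variable B : Type.

(* Trees with node labels in B, without rank constraint; the trees over the
   ranked alphabet (B, rk), i.e. the set T_B, are those satisfying
   [ranked rk]. *)
Inductive tree : Type := Node of B & seq tree.

(* The preorder word of a tree, i.e. the tree written as a string over B. *)
Fixpoint word (t : tree) : seq B :=
  let: Node b ts := t in b :: flatten [seq word s | s <- ts].

Fixpoint ranked (rk : B -> nat) (t : tree) : bool :=
  let: Node b ts := t in (size ts == rk b) && all (ranked rk) ts.

Fixpoint tree_enc (t : tree) : GenTree.tree B :=
  let: Node b ts := t in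
  GenTree.Node 0 (GenTree.Leaf b :: [seq tree_enc s | s <- ts]).

Fixpoint tree_dec (g : GenTree.tree B) : option tree :=
  match g with
  | GenTree.Node _ (GenTree.Leaf b :: gs) =>
      Some (Node b (pmap id [seq tree_dec s | s <- gs]))
  | _ => None
  end.

Fact tree_encK : pcancel tree_enc tree_dec.
Proof.
rewrite /pcancel; fix IH 1; case=> b ts /=; congr (Some (Node _ _)).
elim: ts => [//|t ts IHts] /=.
by rewrite IH /= IHts.
Qed.

End Trees.

HB.instance Definition _ (B : choiceType) :=
  Choice.copy (tree B) (pcan_type (@tree_encK B)).

Fixpoint map_tree (B C : Type) (g : B -> C) (t : tree B) : tree C :=
  let: Node b ts := t in Node (g b) [seq map_tree g s | s <- ts].

(* In trees over A + nat, the symbol [inr j] is the variable x_{j+1}. *)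
Notation xtree A := (tree (A + nat)).

Section Patterns.
Variables (A : eqType) (rk : A -> nat).

Definition xrk (c : A + nat) : nat := if c is inl a then rk a else 0.

Definition vars (t : xtree A) : seq nat :=
  pmap (fun c : A + nat => if c is inr j then Some j else None) (word t).

(* t is in P_A(X_k). *)
Definition pattern_of_rank (k : nat) (t : xtree A) : bool :=
  ranked xrk t && perm_eq (vars t) (iota 0 k).

(* A tree is a pattern of rank k for at most one k, namely its number of
   occurrences of variables. *)
Definition prank (t : xtree A) : nat := size (vars t).

Definition pattern (t : xtree A) : bool := pattern_of_rank (prank t) t.

(* Simultaneous replacement of x_1, x_2, ... by the elements of s. *)
Fixpoint inst (s : seq (xtree A)) (t : xtree A) : xtree A :=
  let: Node c ts := t in
  match c with
  | inl _ => Node c [seq inst s t' | t' <- ts]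
  | inr j => nth t s j
  end.

(* t[sigma <- u]; the default value of nth is never used when sigma and u have
   the same length. *)
Fixpoint subst (sigma : seq A) (u : seq (xtree A)) (t : xtree A) : xtree A :=
  let: Node c ts := t in
  let ts' := [seq subst sigma u s | s <- ts] in
  match c with
  | inl a => if a \in sigma
             then inst ts' (nth (Node c ts') u (index a sigma))
             else Node c ts'
  | inr _ => Node c ts'
  end.

Definition fsubst (sigma : seq A) (u t : seq (xtree A)) : seq (xtree A) :=
  [seq subst sigma u s | s <- t].

End Patterns.

Section Grammars.
Variables (N Sigma : finType) (rkN : N -> nat) (rkS : Sigma -> nat).

Definition sum_rk (c : N + Sigma) : nat :=
  match c with inl a => rkN a | inr s => rkS s end.

Definition forest := seq (xtree (N + Sigma)).

Definition nonterms (t : xtree (N + Sigma)) : seq N :=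
  pmap (fun c : (N + Sigma) + nat => if c is inl (inl a) then Some a else None)
       (word t).

(* The occurrences, with repetitions, of nonterminals in a forest. *)
Definition fnonterms (u : forest) : seq N := flatten [seq nonterms t | t <- u].

(* P_Sigma(X), as a set of patterns over N + Sigma. *)
Definition tpattern (t : xtree (N + Sigma)) : bool :=
  pattern sum_rk t && (nonterms t == [::]).

End Grammars.

(* A rule A -> (u, L) is represented by (A, (u, L)). *)
Record mcftg := MCFTG {
  nt : finType;
  rkN : nt -> nat;
  bignt : {fset (seq nt)};
  term : finType;
  rkS : term -> nat;
  init : bignt;
  rules : {fset (bignt * (forest nt term * {set bignt}))};
  bignt_neq0 : forall A : bignt, val A != [::];
  bignt_uniq : forall A : bignt, uniq (val A);
  bignt_occ : forall A A' : bignt, val A =i val A' -> A = A';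
  term_rk_gt0 : exists s : term, 0 < rkS s;
  init_rk0 : exists2 S : nt, val init = [:: S] & rkN S = 0;
  rulesP : forall (A : bignt) (u : forest nt term) (L : {set bignt}),
    (A, (u, L)) \in rules ->
    [/\ [/\ u != [::], all (pattern (sum_rk rkN rkS)) u,
            uniq (fnonterms u) &
            [seq prank t | t <- u] = [seq rkN a | a <- val A]],
        forall B B' : bignt, B \in L -> B' \in L -> B != B' ->
          [disjoint val B & val B'] &
        forall a : nt,
          a \in fnonterms u <-> exists2 B : bignt, B \in L & a \in val B]
}.

Local Open Scope classical_set_scope.

Section Semantics.
Variable G : mcftg.

Local Notation forestG := (forest (nt G) (term G)).

(* u[B <- f(B) | B in {B_1, ..., B_k}], with Bs = B_1, ..., B_k and
   fs = f(B_1), ..., f(B_k). *)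
Definition link_subst (Bs : seq (bignt G)) (fs : seq forestG) (u : forestG) :
  forestG :=
  fsubst [seq inl a | a <- flatten [seq val B | B <- Bs]] (flatten fs) u.

(* The least family L(G, A). Only the values of f on L matter, and the order in
   which L is enumerated is irrelevant since the links are disjoint. *)
Inductive lang_from : bignt G -> set forestG :=
| LangFrom A u (L : {set bignt G}) (f : bignt G -> forestG) :
    (A, (u, L)) \in rules G ->
    (forall B, B \in L -> all (tpattern (@rkN G) (@rkS G)) (f B)) ->
    (forall B, B \in L ->
       [seq prank t | t <- f B] = [seq rkN a | a <- val B]) ->
    (forall B, B \in L -> lang_from B (f B)) ->
    lang_from A (link_subst (enum L) [seq f B | B <- enum L] u).

Definition lang : set forestG := lang_from (init G).

End Semantics.

Arguments lang_from : clear implicits.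
Arguments lang : clear implicits.

Section RegularTreeGrammars.

Record rtg := RTG {
  rt_nt : finType;
  rt_term : finType;
  rt_rk : rt_term -> nat;
  rt_init : rt_nt;
  rt_rules : {fset (rt_nt * tree (rt_nt + rt_term))};
  rt_ranked : forall A t, (A, t) \in rt_rules ->
    ranked (sum_rk (fun=> 0) rt_rk) t
}.

Variable H : rtg.

Inductive rt_step :
  tree (rt_nt H + rt_term H) -> tree (rt_nt H + rt_term H) -> Prop :=
| RtRoot A t : (A, t) \in rt_rules H -> rt_step (Node (inl A) [::]) t
| RtSub c ts1 t t' ts2 : rt_step t t' ->
    rt_step (Node c (ts1 ++ t :: ts2)) (Node c (ts1 ++ t' :: ts2)).

Definition rt_lang_from (A : rt_nt H) : set (tree (rt_term H)) :=
  [set d | ranked (@rt_rk H) d /\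
           clos_refl_trans _ rt_step (Node (inl A) [::]) (map_tree inr d)].

Definition rt_lang : set (tree (rt_term H)) := rt_lang_from (rt_init H).

End RegularTreeGrammars.

Arguments rt_lang_from : clear implicits.
Arguments rt_lang : clear implicits.

Section DerivationTrees.
Variable G : mcftg.

Definition rule_lhs (r : rules G) : bignt G := (val r).1.
Definition rule_rhs (r : rules G) : forest (nt G) (term G) := (val r).2.1.
Definition rule_links (r : rules G) : {set bignt G} := (val r).2.2.

Definition rule_rk (r : rules G) : nat := #|rule_links r|.

(* A choice, for every rule, of a linear order on its links. *)
Record link_order := LinkOrder {
  ord_links :> rules G -> seq (bignt G);
  ord_linksP : forall r, perm_eq (ord_links r) (enum (rule_links r))
}.

Variable o : link_order.

(* The rule A -> rho(B_1, ..., B_k) of the derivation grammar has left-hand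
   side [rule_lhs rho] and right-hand side [der_rhs rho]. *)
Definition der_rhs (r : rules G) : tree (bignt G + rules G) :=
  Node (inr r) [seq Node (inl B) [::] | B <- o r].

Definition der_rules : {fset (bignt G * tree (bignt G + rules G))} :=
  [fset (rule_lhs r, der_rhs r) | r : rules G]%fset.

Lemma der_ranked A t : (A, t) \in der_rules ->
  ranked (sum_rk (fun=> 0) rule_rk) t.
Proof.
case/imfsetP => r _ [_ ->] /=.
rewrite size_map (perm_size (ord_linksP o r)) -cardE eqxx /=.
by elim: (o r).
Qed.

Definition der : rtg := @RTG _ _ rule_rk (init G) der_rules der_ranked.

(* The value of a derivation tree; it is meaningful on the trees generated by
   [der], in which the i-th subtree below rho derives from the i-th link. *)
Fixpoint dval (d : tree (rules G)) : forest (nt G) (term G) :=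
  let: Node r ds := d in
  link_subst (o r) [seq dval d' | d' <- ds] (rule_rhs r).

End DerivationTrees.

(* Main.v *)
(** A tree over the rules is generated by the derivation grammar from [A] iff
    its root is a rule for [A] and, at every node, the left-hand sides of the
    rules at the children are the links of the rule at that node; the analogous
    property of sentential forms is invariant under derivation steps.  Such
    trees record exactly how a forest is obtained in the least fixed point,
    since the result of substituting for the links does not depend on their
    order and substitution maps terminal patterns to terminal patterns. *)
Require Import Defs.
From mathcomp Require Import all_boot finmap classical_sets.
From Stdlib Require Import Relation_Operators.

Set Implicit Arguments.
Unset Strict Implicit.
Unset Printing Implicit Defensive.

(** * Induction on trees and lookup in flattened lists *)

Lemma tree_ind_in (B : choiceType) (P : tree B -> Prop) :
  (forall b ts, {in ts, forall t, P t} -> P (Node b ts)) -> forall t, P t.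
Proof.
(* The principle generated for this nested type says nothing about the subtrees, so recursion on the
   tree is combined with induction on the list of children. *)
move=> IHP; fix IH 1; case=> b ts; apply: IHP.
elim: ts => [s|t ts IHts s]; first by clear IH; rewrite in_nil.
by rewrite inE => /predU1P[->|]; [exact: IH | exact: IHts].
Qed.

(** [link_subst] looks up a nonterminal in concatenated blocks, one per link. Blocks of equal sizes
    keep keys and values aligned, and only the block of [j] can contain [a]. *)
Lemma nth_flatten_index (X : Type) (J : eqType) (T : eqType)
    (v : J -> seq T) (f : J -> seq X) (s : seq J) (j : J) (a : T) (x0 : X) :
  {in s, forall i, size (f i) = size (v i)} ->
  {in s, forall i, a \in v i -> i = j} -> j \in s -> a \in v j ->
  nth x0 (flatten [seq f i | i <- s]) (index a (flatten [seq v i | i <- s])) =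
  nth x0 (f j) (index a (v j)).
Proof.
move=> + + + av; elim: s => [//|i s IHs] szE aE js /=.
rewrite index_cat; case: ifP => avi; rewrite nth_cat szE ?mem_head//.
  by rewrite index_mem avi -(aE i) ?mem_head.
rewrite ltnNge leq_addr addKn; apply: IHs.
- by move=> k ks; apply: szE; rewrite inE ks orbT.
- by move=> k ks; apply: aE; rewrite inE ks orbT.
- by move: js; rewrite inE => /predU1P[jE|//]; rewrite -jE av in avi.
Qed.

Lemma pmap_flatten (T U : Type) (g : T -> option U) (ss : seq (seq T)) :
  pmap g (flatten ss) = flatten [seq pmap g s | s <- ss].
Proof. by elim: ss => //= s ss <-; rewrite pmap_cat. Qed.

Lemma flatten_map_eq0 (I : Type) (T : eqType) (f : I -> seq T) (s : seq I) :
  (flatten [seq f i | i <- s] == [::]) = all (fun i => f i == [::]) s.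
Proof. by elim: s => //= i s <-; rewrite -!nilpE cat_nilp. Qed.

Lemma flatten_map_flatten (I J T : Type) (f : I -> seq J) (g : J -> seq T)
    (s : seq I) :
  flatten [seq g j | j <- flatten [seq f i | i <- s]] =
  flatten [seq flatten [seq g j | j <- f i] | i <- s].
Proof. by elim: s => //= i s <-; rewrite map_cat flatten_cat. Qed.

Lemma perm_flatten_map (I T : eqType) (f g : I -> seq T) (s : seq I) :
  {in s, forall i, perm_eq (f i) (g i)} ->
  perm_eq (flatten [seq f i | i <- s]) (flatten [seq g i | i <- s]).
Proof.
elim: s => //= i s IHs fg; rewrite perm_cat ?fg ?mem_head// IHs// => j js.
by apply: fg; rewrite inE js orbT.
Qed.

(** * Substituting terminal patterns into patterns *)

Section Substitution.
Variables (N Sigma : finType) (rkN : N -> nat) (rkS : Sigma -> nat).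
Local Notation rk := (sum_rk rkN rkS).
Local Notation xt := (xtree (N + Sigma)).
Implicit Types (t : xt) (ts s us : seq xt).

Lemma vars_inl (a : N + Sigma) ts :
  vars (Node (inl a) ts) = flatten [seq vars t | t <- ts].
Proof. by rewrite /vars /= pmap_flatten -map_comp. Qed.

Lemma vars_inr j ts :
  vars (Node (inr j) ts : xt) = j :: flatten [seq vars t | t <- ts].
Proof. by rewrite /vars /= pmap_flatten -map_comp. Qed.

Lemma nonterms_node (c : N + Sigma + nat) ts :
  nonterms (Node c ts) =
  (if c is inl (inl a) then [:: a] else [::]) ++
  flatten [seq nonterms t | t <- ts].
Proof.
by rewrite /nonterms /= pmap_flatten -map_comp; case: c => [[]|].
Qed.

Lemma tpatternP t : tpattern rkN rkS t ->
  [/\ ranked (xrk rk) t, perm_eq (vars t) (iota 0 (prank t)) & nonterms t = [::]].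
Proof. by case/andP=> /andP[? ?] /eqP. Qed.

(** The default in [inst] is the variable itself; the bound on the indices makes it irrelevant, so
    any [x0] may serve instead. *)
Lemma inst_terminal s x0 t :
  {in s, forall t', ranked (xrk rk) t' /\ nonterms t' = [::]} ->
  ranked (xrk rk) t -> {in vars t, forall j, j < size s} ->
  nonterms t = [::] ->
  [/\ ranked (xrk rk) (inst s t),
      vars (inst s t) = flatten [seq vars (nth x0 s j) | j <- vars t] &
      nonterms (inst s t) = [::]].
Proof.
move=> s_ok; elim/tree_ind_in: t => -[a|j] ts IH; last first.
  move=> /= /andP[/nilP-> _]; rewrite vars_inr /= cats0 => /(_ j (mem_head _ _)).
  move=> js _; rewrite (set_nth_default x0)//.
  by have [rk_j nt_j] := s_ok _ (mem_nth x0 js).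
rewrite vars_inl => /= /andP[/eqP szE /allP rk_ts] lt_ts.
rewrite nonterms_node => /eqP; rewrite -nilpE cat_nilp !nilpE flatten_map_eq0.
case/andP=> /eqP aE /allP nt_ts.
have lt_t t : t \in ts -> {in vars t, forall j, j < size s}.
  by move=> tts j jt; apply: lt_ts; apply/flatten_mapP; exists t.
have {}IH t (tts : t \in ts) := IH t tts (rk_ts t tts) (lt_t t tts)
  (eqP (nt_ts t tts)).
split.
- by rewrite size_map szE eqxx all_map; apply/allP => t /IH[].
- rewrite vars_inl -map_comp flatten_map_flatten; congr flatten.
  by apply/eq_in_map => t /IH[].
- rewrite nonterms_node aE; apply/eqP; rewrite -map_comp flatten_map_eq0.
  by apply/allP => t /IH[_ _ /= ->].
Qed.

(** At a nonterminal, the replacing pattern contains each of its variables exactly once but in any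
    order. Instantiation thus permutes the variable blocks of the transformed subtrees, whence
    [perm_eq] and not equality. *)
Lemma subst_terminal (vs : seq N) us t :
  all (tpattern rkN rkS) us -> map (@prank _) us = map rkN vs ->
  ranked (xrk rk) t -> {subset nonterms t <= vs} ->
  [/\ ranked (xrk rk) (subst [seq inl a | a <- vs] us t),
      perm_eq (vars (subst [seq inl a | a <- vs] us t)) (vars t) &
      nonterms (subst [seq inl a | a <- vs] us t) = [::]].
Proof.
move=> /allP us_ok us_rk; set st := subst _ us.
elim/tree_ind_in: t => c ts IH /= /andP[/eqP szE /allP rk_ts].
rewrite nonterms_node => nt_sub.
have {}IH t (tts : t \in ts) : [/\ ranked (xrk rk) (st t),
    perm_eq (vars (st t)) (vars t) & nonterms (st t) = [::]].
  apply: IH; rewrite ?rk_ts// => a at_; apply: nt_sub; rewrite mem_cat.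
  by apply/orP; right; apply/flatten_mapP; exists t.
have rk_sts : all (ranked (xrk rk)) [seq st t | t <- ts].
  by rewrite all_map; apply/allP => t /IH[].
have nt_sts : flatten [seq nonterms t | t <- [seq st t | t <- ts]] = [::].
  apply/eqP; rewrite -map_comp flatten_map_eq0.
  by apply/allP => t /IH[_ _ /= ->].
have vars_sts : perm_eq (flatten [seq vars t | t <- [seq st t | t <- ts]])
    (flatten [seq vars t | t <- ts]).
  by rewrite -map_comp; apply: perm_flatten_map => t /IH[].
rewrite {1 2 3}/st /= -/st; case: c szE nt_sub => [[a|b]|j] szE nt_sub; last 2 first.
- rewrite ifN; last by apply/mapP => -[].
  by split; rewrite ?vars_inl ?nonterms_node//= size_map szE eqxx.
- by split; rewrite ?vars_inr ?perm_cons ?nonterms_node//= size_map szE eqxx.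
have av : a \in vs by apply: nt_sub; rewrite mem_head.
rewrite /= (mem_map (@inl_inj _ _)) av (index_map (@inl_inj _ _)).
set x0 := Node _ _; set p := nth _ _ _.
have szus : size us = size vs by rewrite -(size_map (@prank _)) us_rk size_map.
have ius : index a vs < size us by rewrite szus index_mem.
have /us_ok/tpatternP[rk_p vars_p nt_p] : p \in us by rewrite mem_nth.
(* The ranks of [us] and [vs] agree index by index, and a ranked node has as many subtrees as the
   rank of its label. *)
have prank_p : prank p = size [seq st t | t <- ts].
  rewrite -(nth_map x0 0 (@prank _)) // us_rk (nth_map a) -?szus// nth_index//.
  by rewrite size_map szE.
rewrite prank_p in vars_p.
have [] := @inst_terminal [seq st t | t <- ts] x0 p.
- move=> t tst; split; first exact: (allP rk_sts).
  by move/eqP: nt_sts; rewrite flatten_map_eq0 => /allP/(_ t tst)/eqP.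
- by [].
- by move=> j; rewrite (perm_mem vars_p) mem_iota.
- by [].
move=> ? vars_i ?; split=> //; rewrite vars_i vars_inl.
apply: perm_trans vars_sts; apply: perm_flatten.
apply: perm_trans (perm_map _ vars_p) _.
by rewrite (map_comp (@vars _) (nth x0 _)) map_nth_iota0// take_size.
Qed.

Lemma fsubst_terminal (vs : seq N) us u :
  all (tpattern rkN rkS) us -> map (@prank _) us = map rkN vs ->
  all (pattern rk) u -> {subset fnonterms u <= vs} ->
  all (tpattern rkN rkS) (fsubst [seq inl a | a <- vs] us u) /\
  map (@prank _) (fsubst [seq inl a | a <- vs] us u) = map (@prank _) u.
Proof.
move=> us_ok us_rk /allP u_ok u_nt.
have st_ok t (tu : t \in u) : [/\ ranked (xrk rk) (subst (map inl vs) us t),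
    perm_eq (vars (subst (map inl vs) us t)) (vars t) &
    nonterms (subst (map inl vs) us t) = [::]].
  have /andP[rk_t _] := u_ok t tu; apply: subst_terminal => // a at_.
  by apply: u_nt; apply/flatten_mapP; exists t.
split; last by rewrite -map_comp; apply/eq_in_map => t /st_ok[_ /perm_size].
rewrite all_map; apply/allP => t tu /=; have [rk_s vars_s nt_s] := st_ok t tu.
rewrite /tpattern /pattern /pattern_of_rank rk_s nt_s eqxx andbT /=.
rewrite /prank (perm_size vars_s); apply: perm_trans vars_s _.
by have /andP[] := u_ok t tu.
Qed.

End Substitution.

(** The two lists enter a substitution only through the lookups at symbols of [sigma], so their
    order can be changed freely. *)
Lemma eq_subst (A : eqType) (sigma sigma' : seq A) (u u' : seq (xtree A)) :
  sigma =i sigma' ->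
  (forall x0, {in sigma, forall a,
     nth x0 u (index a sigma) = nth x0 u' (index a sigma')}) ->
  subst sigma u =1 subst sigma' u'.
Proof.
move=> eq_s eq_u; rewrite /eqfun; fix IH 1; case=> c ts /=.
have -> : [seq subst sigma u s | s <- ts] = [seq subst sigma' u' s | s <- ts].
  by elim: ts => //= t ts ->; rewrite IH.
by case: c => // a; rewrite -eq_s; case: ifP => // /eq_u->.
Qed.

(** * Independence of the link order, and terminality of the languages *)

Section Grammar.
Variable G : mcftg.
Implicit Types (A B : bignt G) (L : {set bignt G}) (Bs : seq (bignt G)).
Implicit Types (f : bignt G -> forest (nt G) (term G)).

(** By disjointness a nonterminal lies in a single link, so its lookup falls in the block of that
    link under either enumeration. *)
Lemma link_subst_perm Bs Bs' f u : perm_eq Bs Bs' ->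
  {in Bs &, forall B B', B != B' -> [disjoint val B & val B']} ->
  {in Bs, forall B, size (f B) = size (val B)} ->
  link_subst Bs [seq f B | B <- Bs] u = link_subst Bs' [seq f B | B <- Bs'] u.
Proof.
move=> eqBs disj szf; rewrite /link_subst /fsubst; apply: eq_map.
have eqF := perm_flatten (perm_map val eqBs).
apply: eq_subst => [a|x0 a]; first exact/perm_mem/perm_map.
case/mapP=> b /flatten_mapP[B Bin bB] ->.
rewrite !(index_map (@inl_inj _ _)).
have uniqB C : C \in Bs -> b \in val C -> C = B.
  move=> Cin bC; apply/eqP; apply: contraLR bC => neCB.
  by rewrite (disjointFl (disj _ _ Cin Bin neCB)).
rewrite (@nth_flatten_index _ _ _ val f _ B)//.
have memBs := perm_mem eqBs.
rewrite (@nth_flatten_index _ _ _ val f _ B) -?memBs// => C; rewrite -memBs.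
  exact: szf.
exact: uniqB.
Qed.

Lemma lang_from_terminal A u : lang_from G A u ->
  all (tpattern (@rkN G) (@rkS G)) u /\ map (@prank _) u = map (@rkN G) (val A).
Proof.
case=> {}A {}u L f r_in f_ok f_rk _.
have [[_ u_ok _ <-] _ ntE] := rulesP r_in.
rewrite /link_subst; apply: fsubst_terminal => //.
- apply/allP => t /flatten_mapP[B]; rewrite mem_enum => BL.
  exact/allP/f_ok.
- rewrite !map_flatten -!map_comp; congr flatten.
  by apply/eq_in_map => B; rewrite mem_enum => /f_rk.
- move=> a /ntE[B BL aB]; apply/flatten_mapP; exists B => //.
  by rewrite mem_enum.
Qed.

(** * Local characterization of the trees generated by the derivation grammar *)

Variable o : link_order G.

Definition lhs_root (d : tree (rules G)) : bignt G :=
  let: Node r _ := d in rule_lhs r.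

(** Equality of sequences also fixes the number of children, so rankedness follows. *)
Fixpoint well_linked (d : tree (rules G)) : bool :=
  let: Node r ds := d in (map lhs_root ds == o r) && all well_linked ds.

Definition sent_root (t : tree (bignt G + rules G)) : bignt G :=
  let: Node c _ := t in match c with inl B => B | inr r => rule_lhs r end.

Fixpoint sent_linked (t : tree (bignt G + rules G)) : bool :=
  let: Node c ts := t in
  match c with
  | inl _ => nilp ts
  | inr r => (map sent_root ts == o r) && all sent_linked ts
  end.

Local Notation der_step := (@Defs.rt_step (der o)).

(** A step expands a leaf by a rule whose left-hand side is that leaf; the root label seen from the
    parent does not change, so the condition at the parent survives. *)
Lemma der_step_linked t t' : der_step t t' -> sent_linked t ->
  sent_linked t' /\ sent_root t' = sent_root t.
Proof.
elim=> [A {}t /imfsetP[r _ [-> ->]] _ /=|c ts1 {}t {}t' ts2 _ IH].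
  split=> //; rewrite -map_comp map_id eqxx all_map.
  by apply/allP.
case: c => [B|r] /=; first by case: ts1.
rewrite !map_cat !all_cat /= => /andP[lk /and3P[-> /IH[-> ->] ->]].
by rewrite lk.
Qed.

Lemma sent_root_map d : sent_root (map_tree inr d) = lhs_root d.
Proof. by case: d. Qed.

Lemma sent_linked_map d : sent_linked (map_tree inr d) = well_linked d.
Proof.
elim/tree_ind_in: d => r ds IH /=.
rewrite -map_comp (eq_map sent_root_map) all_map; congr andb.
exact: eq_in_all.
Qed.

Lemma rt_sub_steps c (ts1 ts2 : seq (tree (bignt G + rules G))) t t' :
  clos_refl_trans _ der_step t t' ->
  clos_refl_trans _ der_step
    (Node c (ts1 ++ t :: ts2)) (Node c (ts1 ++ t' :: ts2)).
Proof.
elim=> [? ? ?|?|? t1 ? _ s1 _ s2]; first exact/rt_step/RtSub.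
- exact: rt_refl.
- exact: rt_trans s1 s2.
Qed.

Lemma well_linked_steps d : well_linked d ->
  clos_refl_trans _ der_step
    (Node (inl (lhs_root d)) [::]) (map_tree inr d).
Proof.
elim/tree_ind_in: d => r ds IH /= /andP[/eqP dsE /allP ds_ok].
apply: (@rt_trans _ _ _ (der_rhs o r)).
  by apply/rt_step/RtRoot/imfsetP; exists r.
rewrite /der_rhs -dsE -map_comp.
have {}IH : {in ds, forall d, clos_refl_trans _ der_step
    (Node (inl (lhs_root d)) [::]) (map_tree inr d)}.
  by move=> d dds; apply: IH => //; apply: ds_ok.
(* The children are derived from left to right; [ts] collects those already finished. *)
suff steps ts : clos_refl_trans _ der_step
    (Node (inr r) (ts ++ [seq Node (inl (lhs_root d)) [::] | d <- ds]))
    (Node (inr r) (ts ++ [seq map_tree inr d | d <- ds])) by exact: (steps [::]).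
elim: ds ts IH {dsE ds_ok} => [|d ds IHds] ts IH /=; first exact: rt_refl.
apply: rt_trans (rt_sub_steps _ _ _ (IH d (mem_head _ _))) _.
rewrite -!cat_rcons; apply: IHds => d' d'ds.
by apply: IH; rewrite inE d'ds orbT.
Qed.

Lemma well_linked_ranked d : well_linked d -> ranked (@rule_rk G) d.
Proof.
elim/tree_ind_in: d => r ds IH /= /andP[/eqP dsE /allP ds_ok].
rewrite -(size_map lhs_root) dsE (perm_size (ord_linksP o r)) -cardE eqxx.
by apply/allP => d dds; apply: IH => //; apply: ds_ok.
Qed.

Lemma rt_lang_fromE A d :
  rt_lang_from (der o) A d <-> well_linked d /\ lhs_root d = A.
Proof.
split=> [[_ st]|[d_ok <-]]; last first.
  by split; [exact: well_linked_ranked | exact: well_linked_steps].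
rewrite -sent_linked_map -sent_root_map.
(* Phrased as an implication between both ends of the derivation, the invariant composes under
   transitivity. *)
have {st} : sent_linked (Node (inl A) [::]) ->
    sent_linked (map_tree inr d) /\
    sent_root (map_tree inr d) = sent_root (Node (inl A) [::]).
  elim: st => [t t' /der_step_linked//|//|t1 t2 t3 _ IH1 _ IH2 /IH1[/IH2[? ->]]].
  by [].
exact.
Qed.

(** * From the least fixed point to derivation trees and back *)

Lemma lang_from_dval A u : lang_from G A u ->
  exists2 d, well_linked d /\ lhs_root d = A & dval o d = u.
Proof.
elim=> {}A {}u L f r_in f_ok f_rk _ IH.
have [_ disj _] := rulesP r_in.
pose r : rules G := [` r_in]%fset.
have {}IH : {in o r, forall B,
    exists2 d, well_linked d /\ lhs_root d = B & dval o d = f B}.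
  by move=> B; rewrite (perm_mem (ord_linksP o r)) mem_enum => /IH.
(* Each link only has some tree; induction along the finite sequence of links gathers one per
   link. *)
have [ds [ds_ok dsE dvE]] : exists ds, [/\ all well_linked ds,
    map lhs_root ds = o r & map (dval o) ds = map f (o r)].
  elim: (ord_links o r) IH => [|B Bs IHBs] IH; first by exists [::].
  have [B'|ds [dsl dsr dsv]] := IHBs.
    by move=> B'in; apply: IH; rewrite inE B'in orbT.
  have [d [dl dr] dv] := IH B (mem_head _ _).
  by exists (d :: ds) => /=; rewrite dl dsl dr dsr dv dsv.
exists (Node r ds); first by rewrite /= dsE eqxx ds_ok.
(* [dval] follows the chosen order [o], whereas [LangFrom] enumerates the set of links. *)
rewrite /= dvE; apply: link_subst_perm; first exact: (ord_linksP o r).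
- move=> B B'; rewrite !(perm_mem (ord_linksP o r)) !mem_enum.
  exact: disj.
- move=> B; rewrite (perm_mem (ord_linksP o r)) mem_enum => /f_rk.
  by move=> /(congr1 size); rewrite !size_map.
Qed.

Lemma well_linked_lang d : well_linked d ->
  lang_from G (lhs_root d) (dval o d).
Proof.
elim/tree_ind_in: d => r ds IH /= /andP[/eqP dsE /allP ds_ok].
have r_in : (rule_lhs r, (rule_rhs r, rule_links r)) \in rules G.
  by rewrite /rule_lhs /rule_rhs /rule_links -!surjective_pairing; exact: valP.
have o_uniq : uniq (o r) by rewrite (perm_uniq (ord_linksP o r)) enum_uniq.
(* The function on links required by [LangFrom] is read off by position; it is well defined because
   the links in [o r] are distinct. The default is reached only outside the links. *)
pose f B := nth [::] (map (dval o) ds) (index B (o r)).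
have fE : map (dval o) ds = map f (o r).
  have szo : size ds = size (o r) by rewrite -dsE size_map.
  apply: (@eq_from_nth _ [::]) => [|i]; rewrite !size_map// => i_lt.
  by rewrite (nth_map (rule_lhs r)) -?szo// /f index_uniq -?szo.
have f_lang B : B \in rule_links r -> lang_from G B (f B).
  rewrite -mem_enum -(perm_mem (ord_linksP o r)) => Bo.
  have iB : index B (o r) < size ds by rewrite -(size_map lhs_root) dsE index_mem.
  have d0 := Node r ds; rewrite /f (nth_map d0)//.
  rewrite -[B in lang_from G B](nth_index B Bo) -{1}dsE (nth_map d0)//.
  by apply: IH; [|apply: ds_ok]; rewrite mem_nth.
have [_ disj _] := rulesP r_in.
rewrite fE (@link_subst_perm _ _ _ _ (ord_linksP o r)).
- by apply: LangFrom => // B /f_lang/lang_from_terminal[].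
- move=> B B'; rewrite !(perm_mem (ord_linksP o r)) !mem_enum.
  exact: disj.
- move=> B; rewrite (perm_mem (ord_linksP o r)) mem_enum.
  by move=> /f_lang/lang_from_terminal[_ /(congr1 size)]; rewrite !size_map.
Qed.

End Grammar.

Local Open Scope classical_set_scope.

Theorem theorem9 (G : mcftg) (o : link_order G) :
  (forall A : bignt G,
     lang_from G A = [set dval o d | d in rt_lang_from (der o) A]) /\
  lang G = [set dval o d | d in rt_lang (der o)].
Proof.
have langE (A : bignt G) :
    lang_from G A = [set dval o d | d in rt_lang_from (der o) A].
  apply/seteqP; split=> u.
    by move=> /(lang_from_dval o)[d d_ok <-]; exists d => //; apply/rt_lang_fromE.
  by case=> d /rt_lang_fromE[d_ok <-] <-; apply: well_linked_lang.
by split=> //; apply: langE.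
Qed.
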